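(* For $n=2$, the algorithm for Shifted Combinatorial Optimization over independence systems presented by a linear optimization oracle that is described in the context has approximation ratio $\frac 35$: for every independence system $S\subseteq\{0,1\}^d$ and every $c\in\mathbb{Z}^{d\times 2}$, it returns a matrix $y\in S^2$ with $c\,\overline{y}\ge \frac35\max\{c\,\overline{z} : z\in S^2\}$.
   Context: For a matrix $x$, $x^j$ denotes its $j$-th column. $S^n$ is the set of $d\times n$ matrices all of whose columns lie in $S$. The shift $\overline{x}$ of $x$ is the unique matrix obtained by permuting entries within each row so that each row is nonincreasing; $cx:=\sum_{i,j}c_{i,j}x_{i,j}$. Shifted Combinatorial Optimization (SCO): given $S\subseteq\{0,1\}^d$ and $c\in\mathbb{Z}^{d\times n}$, solve $\max\{c\,\overline{x}:x\in S^n\}$. $S$ is an independence system if $0\in S$ and $u\le v\in S$, $u\in\{0,1\}^d$ imply $u\in S$. A linear optimization oracle for $S$, queried on $w\in\mathbb{Z}^d$, returns $s\in S$ maximizing $ws$. An algorithm has approximation ratio $\alpha\le 1$ if it always returns a feasible solution with objective value at least $\alpha$ times the optimum. Disjoint Union Problem (DUP) with $k$ columns and weights $w\in\mathbb{Z}^d$: $\max\{w\sum_{j=1}^k x^j : x\in S^k,\ \sum_{j=1}^k x^j\in\{0,1\}^d\}$. Greedy algorithm for DUP: successively for $r=1,\dots,k$ query the oracle on the weights obtained from $w$ by setting to $0$ the weights of elements covered by previously obtained vectors, obtaining $x^r\in S$; then in each row of $[x^1,\dots,x^k]$ change all $1$'s but the first to $0$. It has approximation ratio $1-(1-\frac1k)^k$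 for DUP with $k$ columns (so $\frac34$ for $k=2$, and it is exact for $k=1$). Cleaning procedure applied to $x\in S^n$: for each $i\in\{1,\dots,d\}$ let $m(i,x)=\sum_j x_{i,j}$ and let $p(i,x)$ be a maximizer of $\sum_{j=1}^{r}c_{i,j}$ over $0\le r\le m(i,x)$; replace exactly $m(i,x)-p(i,x)$ of the $1$'s in row $i$ of $x$ by $0$'s. The algorithm for $n=2$ constructs two candidate solutions and returns the one with larger objective value $c\,\overline{x}$. Candidate $\ell=0$: apply the greedy algorithm to DUP with $k=2$ columns and weights $w_i=\max_{0\le q\le 1}\sum_{j=1}^q c_{i,j}$ and apply the cleaning procedure to the resulting $d\times 2$ matrix. Candidate $\ell=1$: solve exactly (by one oracle call) DUP with $k=1$ column and weights $w_i=\max_{0\le q\le 2}\sum_{j=1}^q c_{i,j}$, take two copies of the resulting column, and apply the cleaning procedure. *)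

(* Defs.v *)
From HB Require Import structures.
From mathcomp Require Import all_boot all_order all_algebra.

Set Implicit Arguments.
Unset Strict Implicit.
Unset Printing Implicit Defensive.

Import Order.TTheory GRing.Theory Num.Theory.
Local Open Scope ring_scope.

(* Vectors of {0,1}^d are elements of 'cV[bool]_d, 0/1 matrices are elements
   of 'M[bool]_(d, n); booleans are read as 0/1 through the coercion to nat. *)

Definition dot (d n : nat) (c : 'M[int]_(d, n)) (x : 'M[bool]_(d, n)) : int :=
  \sum_(i < d) \sum_(j < n) c i j * (x i j)%:R.

Definition shift (d n : nat) (x : 'M[bool]_(d, n)) : 'M[bool]_(d, n) :=
  \matrix_(i < d, j < n)
    tnth [tuple of sort (fun a b : bool => (b <= a)%N) [tuple x i k | k < n]] j.

Definition colpow (d : nat) (S : {set 'cV[bool]_d}) (n : nat) :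
    {set 'M[bool]_(d, n)} :=
  [set x : 'M[bool]_(d, n) | [forall j : 'I_n, col j x \in S]].

Definition independence_system (d : nat) (S : {set 'cV[bool]_d}) : Prop :=
  const_mx false \in S /\
  forall u v : 'cV[bool]_d,
    (forall i, (u i ord0 <= v i ord0)%N) -> v \in S -> u \in S.

Definition sco_obj (d n : nat) (c : 'M[int]_(d, n)) (x : 'M[bool]_(d, n)) :
  int := dot c (shift x).

(* When the zero vector is in S, the default value 0 of the iterated maximum
   is the objective value of the zero matrix, which belongs to S^n. *)
Definition sco_max (d : nat) (S : {set 'cV[bool]_d}) (n : nat)
    (c : 'M[int]_(d, n)) : int :=
  \big[Num.max/0]_(z in colpow S n) sco_obj c z.

(* oracle w is the nonempty set of the answers that the oracle may return when
   queried on w. A deterministic oracle is the case of singletons; in general,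
   repeating a query may yield another maximizer. *)
Definition linear_oracle (d : nat) (S : {set 'cV[bool]_d})
    (oracle : 'cV[int]_d -> {set 'cV[bool]_d}) : Prop :=
  forall w : 'cV[int]_d,
    oracle w != set0 /\
    forall s, s \in oracle w ->
      s \in S /\ forall t, t \in S -> dot w t <= dot w s.

Definition covered_before (d k : nat) (x : 'M[bool]_(d, k)) (i : 'I_d)
    (r : 'I_k) : bool :=
  [exists j : 'I_k, (j < r)%N && x i j].

Definition residual_weight (d k : nat) (w : 'cV[int]_d) (x : 'M[bool]_(d, k))
    (r : 'I_k) : 'cV[int]_d :=
  \col_(i < d) (if covered_before x i r then 0 else w i ord0).

Definition keep_first (d k : nat) (x : 'M[bool]_(d, k)) : 'M[bool]_(d, k) :=
  \matrix_(i < d, r < k) (x i r && ~~ covered_before x i r).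

(* y is a possible output of the greedy algorithm for DUP with k columns and
   weights w; x collects the successive oracle answers, the r-th query
   depending only on the columns of x before the r-th one. *)
Definition greedy_dup (d k : nat) (oracle : 'cV[int]_d -> {set 'cV[bool]_d})
    (w : 'cV[int]_d) (y : 'M[bool]_(d, k)) : Prop :=
  exists x : 'M[bool]_(d, k),
    (forall r : 'I_k, col r x \in oracle (residual_weight w x r)) /\
    y = keep_first x.

Definition prefix_sum (d n : nat) (c : 'M[int]_(d, n)) (i : 'I_d) (r : nat) :
  int := \sum_(j < n | (j < r)%N) c i j.

(* The default value 0 of the iterated maximum is its term q = 0. *)
Definition prefix_weight (d n : nat) (c : 'M[int]_(d, n)) (l : nat) :
    'cV[int]_d :=
  \col_(i < d) \big[Num.max/0]_(0 <= q < l.+1) prefix_sum c i q.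

Definition row_count (d n : nat) (x : 'M[bool]_(d, n)) (i : 'I_d) : nat :=
  (\sum_(j < n) x i j)%N.

(* y is a possible result of cleaning x: neither the maximizer p nor the
   choice of the removed ones is specified by the procedure. *)
Definition cleaning (d n : nat) (c : 'M[int]_(d, n)) (x y : 'M[bool]_(d, n)) :
    Prop :=
  forall i : 'I_d,
    exists p : nat,
      [/\ (p <= row_count x i)%N,
          forall r : nat, (r <= row_count x i)%N ->
            prefix_sum c i r <= prefix_sum c i p,
          forall j : 'I_n, y i j -> x i j
        & #|[set j : 'I_n | x i j && ~~ y i j]| = (row_count x i - p)%N].

Definition candidate0 (d : nat) (oracle : 'cV[int]_d -> {set 'cV[bool]_d})
    (c : 'M[int]_(d, 2)) (y : 'M[bool]_(d, 2)) : Prop :=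
  exists x : 'M[bool]_(d, 2),
    greedy_dup oracle (prefix_weight c 1) x /\ cleaning c x y.

(* DUP with one column is linear optimization over S, hence the single query. *)
Definition candidate1 (d : nat) (oracle : 'cV[int]_d -> {set 'cV[bool]_d})
    (c : 'M[int]_(d, 2)) (y : 'M[bool]_(d, 2)) : Prop :=
  exists s : 'cV[bool]_d,
    s \in oracle (prefix_weight c 2) /\
    cleaning c (\matrix_(i < d, j < 2) s i ord0) y.

(* y is a possible output of the algorithm for n = 2; in case of a tie either
   candidate may be returned. *)
Definition sco2_output (d : nat) (oracle : 'cV[int]_d -> {set 'cV[bool]_d})
    (c : 'M[int]_(d, 2)) (y : 'M[bool]_(d, 2)) : Prop :=
  exists y0 y1 : 'M[bool]_(d, 2),
    [/\ candidate0 oracle c y0,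
        candidate1 oracle c y1,
        y = y0 \/ y = y1
      & sco_obj c y = Num.max (sco_obj c y0) (sco_obj c y1)].

(* Main.v *)
(* Given z in S^2, let A and B be the sets of rows where z has exactly one,
   respectively two ones, and let u and v be the weights used for the
   candidates 0 and 1, so that u <= v and c(shift z) <= u(A) + v(B).  The
   columns of z split A and share B, hence the better one has v-weight at least
   u(A)/2 + v(B), which candidate 1 attains; candidate 0 attains 3/4 u(A).  The
   combination 2/5, 3/5 of these two bounds is at least 3/5 (u(A) + v(B)). *)
Require Import Defs.
From HB Require Import structures.
From mathcomp Require Import all_boot all_order all_algebra.
From mathcomp Require Import zify lra.

Set Implicit Arguments.
Unset Strict Implicit.
Unset Printing Implicit Defensive.

Import Order.TTheory GRing.Theory Num.Theory.
Local Open Scope ring_scope.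

(** * Shifted rows and the row-wise objective *)

Lemma sort_bool (s : seq bool) :
  sort (fun a b : bool => (b <= a)%N) s =
  nseq (count id s) true ++ nseq (count negb s) false.
Proof.
apply: (@sorted_eq _ (fun a b : bool => (b <= a)%N)).
- by move=> [] [] [].
- by move=> [] [].
- by apply: sort_sorted => - [] [].
(* [true] comes first in this order, so a leading [true] is harmless and turns sortedness into a
   [path] statement suited to induction. *)
- apply: (@path_sorted _ _ true); elim: (count id s) => //=.
  by case: (count negb s) => //=; elim.
- rewrite perm_sort; apply/allP => b _ /=.
  rewrite count_cat !count_nseq /=.
  by case: b; rewrite /= mul1n mul0n ?addn0; apply/eqP/eq_count => - [].
Qed.

Lemma shiftE (d n : nat) (x : 'M[bool]_(d, n)) (i : 'I_d) (j : 'I_n) :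
  shift x i j = (j < row_count x i)%N.
Proof.
rewrite mxE (tnth_nth false) /= sort_bool.
have -> : count id [seq x i k | k <- enum 'I_n] = row_count x i.
  by rewrite count_map -sum1_count big_enum_cond big_mkcond /row_count;
    apply: eq_bigr => k _ /=; case: (x i k).
rewrite nth_cat size_nseq !nth_nseq.
by case: (ltnP j (row_count x i)) => // _; case: ifP.
Qed.

(** The shift remembers only how many ones each row has, so the objective decouples; this is what
    lets every later bound be proved row by row. *)
Lemma sco_objE (d n : nat) (c : 'M[int]_(d, n)) (x : 'M[bool]_(d, n)) :
  sco_obj c x = \sum_(i < d) prefix_sum c i (row_count x i).
Proof.
apply: eq_bigr => i _; rewrite /prefix_sum [RHS]big_mkcond.
apply: eq_bigr => j _.
by rewrite shiftE; case: ifP => _; rewrite ?mulr1 ?mulr0.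
Qed.

(** * Prefix sums and their running maxima *)

Lemma prefix_sum0 (d n : nat) (c : 'M[int]_(d, n)) (i : 'I_d) :
  prefix_sum c i 0 = 0.
Proof. by rewrite /prefix_sum big_pred0. Qed.

Lemma prefix_weight_ge (d n : nat) (c : 'M[int]_(d, n)) (l q : nat) (i : 'I_d) :
  (q <= l)%N -> prefix_sum c i q <= prefix_weight c l i ord0.
Proof.
by move=> le_ql; rewrite mxE; apply: le_bigmax_seq; rewrite // mem_index_iota.
Qed.

Lemma prefix_weight_ge0 (d n : nat) (c : 'M[int]_(d, n)) (l : nat) (i : 'I_d) :
  0 <= prefix_weight c l i ord0.
Proof. by rewrite -(prefix_sum0 c i) prefix_weight_ge. Qed.

Lemma prefix_weight_le (d n : nat) (c : 'M[int]_(d, n)) (l : nat) (i : 'I_d)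
    (t : int) :
  (forall q, (q <= l)%N -> prefix_sum c i q <= t) ->
  prefix_weight c l i ord0 <= t.
Proof.
move=> le_t; rewrite mxE big_seq; apply: bigmax_le.
  by rewrite -(prefix_sum0 c i) le_t.
by move=> q; rewrite mem_index_iota; apply: le_t.
Qed.

Lemma prefix_weight_homo (d n : nat) (c : 'M[int]_(d, n)) (l l' : nat)
    (i : 'I_d) :
  (l <= l')%N -> prefix_weight c l i ord0 <= prefix_weight c l' i ord0.
Proof.
move=> le_ll'; apply: prefix_weight_le => q le_ql.
by apply: prefix_weight_ge; apply: leq_trans le_ll'.
Qed.

(** * The cleaning procedure *)

Lemma row_count_card (d n : nat) (x : 'M[bool]_(d, n)) (i : 'I_d) :
  row_count x i = #|[set j | x i j]|.
Proof.
rewrite /row_count -sum1_card [RHS]big_mkcond.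
by apply: eq_bigr => j _; rewrite inE.
Qed.

(** Cleaning leaves exactly [p] ones in row [i], and [p] beats every length up to the old row count,
    in particular every length up to [l]. *)
Lemma cleaning_prefix_weight (d n : nat) (c : 'M[int]_(d, n))
    (x y : 'M[bool]_(d, n)) (l : nat) (i : 'I_d) :
  cleaning c x y -> (l <= row_count x i)%N ->
  prefix_weight c l i ord0 <= prefix_sum c i (row_count y i).
Proof.
move=> /(_ i)[p [le_p max_p yx card_p]] le_l.
suff -> : row_count y i = p.
  by apply: prefix_weight_le => q le_q; apply: max_p; apply: leq_trans le_l.
have -> : row_count y i = (row_count x i - (row_count x i - p))%N; last by lia.
rewrite -card_p !row_count_card.
have -> : [set j | x i j && ~~ y i j] = [set j | x i j] :\: [set j | y i j].
  by apply/setP => j; rewrite !inE andbC.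
have sub_yx : [set j | y i j] \subset [set j | x i j].
  by apply/subsetP => j; rewrite !inE; apply: yx.
by rewrite cardsD (setIidPr sub_yx) subKn // subset_leq_card.
Qed.

(** Keeping the first [p i] ones of each row, for some maximizer [p i], is an admissible choice. *)
Lemma cleaning_exists (d n : nat) (c : 'M[int]_(d, n)) (x : 'M[bool]_(d, n)) :
  exists y, cleaning c x y.
Proof.
pose m := row_count x.
pose p i : 'I_(m i).+1 := [arg max_(r > ord0) prefix_sum c i (r : 'I_(m i).+1)]%O.
pose T i := [set j | x i j].
pose y := \matrix_(i < d, j < n) (j \in take (p i) (enum (T i))).
exists y => i; exists (p i).
have le_p : (p i <= m i)%N by rewrite -ltnS.
have yx j : y i j -> x i j.
  by rewrite mxE => /mem_take; rewrite mem_enum inE.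
split=> // [r le_r|].
  rewrite /p; case: arg_maxP => // q _ /(_ (Ordinal (le_r : r < (m i).+1)%N)).
  exact.
have -> : [set j | x i j && ~~ y i j] = T i :\: [set j in take (p i) (enum (T i))].
  by apply/setP => j; rewrite !inE andbC mxE.
rewrite cardsD (setIidPr _); last first.
  by apply/subsetP => j; rewrite !inE => /mem_take; rewrite mem_enum inE.
have -> : #|[set j in take (p i) (enum (T i))]| = size (take (p i) (enum (T i))).
  by rewrite cardsE; apply/card_uniqP; rewrite take_uniq ?enum_uniq.
have cardT : #|T i| = m i by rewrite /m row_count_card.
(* When [p i] is not below [m i], the two are equal by [le_p]. *)
by rewrite size_take -cardE cardT; case: ltnP => // le_m;
  congr (_ - _)%N; apply/anti_leq/andP.
Qed.

Lemma cleaning_colpow (d n : nat) (S : {set 'cV[bool]_d}) (c : 'M[int]_(d, n))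
    (x y : 'M[bool]_(d, n)) :
  independence_system S -> cleaning c x y -> x \in colpow S n ->
  y \in colpow S n.
Proof.
move=> [_ downS] clean; rewrite !inE => /forallP xS; apply/forallP => j.
apply: downS (xS j) => i; rewrite !mxE.
by have [p [_ _ /(_ j) yx _]] := clean i; case: (y i j) yx => // ->.
Qed.

(** * Two-column matrices and existence of outputs *)

Lemma dot_col (d : nat) (w : 'cV[int]_d) (s : 'cV[bool]_d) :
  dot w s = \sum_(i < d) w i ord0 * (s i ord0)%:R.
Proof. by apply: eq_bigr => i _; rewrite big_ord1. Qed.

Lemma covered_before0 (d : nat) (x : 'M[bool]_(d, 2)) (i : 'I_d) :
  covered_before x i ord0 = false.
Proof. by apply/negbTE/negP => /existsP[j /andP[]]. Qed.

Lemma covered_before1 (d : nat) (x : 'M[bool]_(d, 2)) (i : 'I_d) :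
  covered_before x i ord_max = x i ord0.
Proof.
apply/existsP/idP => [[j /andP[j1]]|xi0]; last by exists ord0.
by rewrite (_ : j = ord0) //; apply: val_inj => /=; move: j1;
  rewrite ltnS leqn0 => /eqP.
Qed.

Lemma row_count2 (d : nat) (x : 'M[bool]_(d, 2)) (i : 'I_d) :
  row_count x i = (x i ord0 + x i ord_max)%N.
Proof.
rewrite /row_count big_ord_recl big_ord1; congr (_ + nat_of_bool (x i _))%N.
exact: val_inj.
Qed.

Lemma ord2P (P : 'I_2 -> Prop) : P ord0 -> P ord_max -> forall r, P r.
Proof.
move=> P0 P1 [[|[|//]] lt_r].
- by rewrite (_ : Ordinal _ = ord0) //; apply: val_inj.
- by rewrite (_ : Ordinal _ = ord_max) //; apply: val_inj.
Qed.

(** The queries are answered in order: [w'] is computed from the first answer [s], and the matrix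
    with columns [s] and [t] then has [w] and [w'] as its residual weights. *)
Lemma greedy_dup_exists (d : nat) (S : {set 'cV[bool]_d})
    (oracle : 'cV[int]_d -> {set 'cV[bool]_d}) (w : 'cV[int]_d) :
  linear_oracle S oracle ->
  exists y : 'M[bool]_(d, 2), greedy_dup oracle w y.
Proof.
move=> oracleS; have [/set0Pn[s sw] _] := oracleS w.
pose w' := \col_(i < d) (if s i ord0 then 0 else w i ord0).
have [/set0Pn[t tw] _] := oracleS w'.
pose x := \matrix_(i < d, j < 2) (if j == ord0 then s i ord0 else t i ord0).
exists (keep_first x), x; split=> //; apply: ord2P.
- rewrite (_ : col _ x = s); last by apply/colP => i; rewrite !mxE.
  rewrite (_ : residual_weight w x ord0 = w) //.
  by apply/colP => i; rewrite !mxE covered_before0.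
- rewrite (_ : col _ x = t); last by apply/colP => i; rewrite !mxE.
  rewrite (_ : residual_weight w x ord_max = w') //.
  by apply/colP => i; rewrite !mxE covered_before1 !mxE.
Qed.

Lemma keep_first_colpow (d k : nat) (S : {set 'cV[bool]_d})
    (x : 'M[bool]_(d, k)) :
  independence_system S -> x \in colpow S k -> keep_first x \in colpow S k.
Proof.
move=> [_ downS]; rewrite !inE => /forallP xS; apply/forallP => j.
by apply: downS (xS j) => i; rewrite !mxE; case: (x i j); rewrite //= leq_b1.
Qed.

Lemma sco2_output_exists (d : nat) (S : {set 'cV[bool]_d})
    (oracle : 'cV[int]_d -> {set 'cV[bool]_d}) (c : 'M[int]_(d, 2)) :
  linear_oracle S oracle -> exists y, sco2_output oracle c y.
Proof.
move=> oracleS.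
have [x gx] := greedy_dup_exists (prefix_weight c 1) oracleS.
have [y0 cy0] := cleaning_exists c x.
have [/set0Pn[s sw] _] := oracleS (prefix_weight c 2).
have [y1 cy1] := cleaning_exists c (\matrix_(i < d, j < 2) s i ord0).
have c0 : candidate0 oracle c y0 by exists x.
have c1 : candidate1 oracle c y1 by exists s.
case: (leP (sco_obj c y0) (sco_obj c y1)) => le01.
- by exists y1, y0, y1; split; [| |right|rewrite max_r].
- by exists y0, y0, y1; split; [| |left|rewrite max_l // ltW].
Qed.

(** * Feasibility of the candidates *)

Lemma candidate0_colpow (d : nat) (S : {set 'cV[bool]_d})
    (oracle : 'cV[int]_d -> {set 'cV[bool]_d}) (c : 'M[int]_(d, 2))
    (y : 'M[bool]_(d, 2)) :
  independence_system S -> linear_oracle S oracle -> candidate0 oracle c y ->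
  y \in colpow S 2.
Proof.
move=> indS oracleS [_ [[x [xo ->]] clean]].
apply: (cleaning_colpow indS clean); apply: (keep_first_colpow indS).
rewrite inE; apply/forallP => r.
by have [_ /(_ _ (xo r))[]] :=
  oracleS (residual_weight (prefix_weight c 1) x r).
Qed.

Lemma candidate1_colpow (d : nat) (S : {set 'cV[bool]_d})
    (oracle : 'cV[int]_d -> {set 'cV[bool]_d}) (c : 'M[int]_(d, 2))
    (y : 'M[bool]_(d, 2)) :
  independence_system S -> linear_oracle S oracle -> candidate1 oracle c y ->
  y \in colpow S 2.
Proof.
move=> indS oracleS [s [so clean]]; apply: (cleaning_colpow indS clean).
rewrite inE; apply/forallP => r; rewrite (_ : col r _ = s).
  by have [_ /(_ _ so)[]] := oracleS (prefix_weight c 2).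
by apply/colP => i; rewrite !mxE.
Qed.

(** * Approximation guarantees *)

(** Rows in the support of the oracle answer [s] hold two ones, so cleaning earns their full weight
    there and at least 0 elsewhere; and [s] is at least as heavy as [t]. *)
Lemma candidate1_ge (d : nat) (S : {set 'cV[bool]_d})
    (oracle : 'cV[int]_d -> {set 'cV[bool]_d}) (c : 'M[int]_(d, 2))
    (y : 'M[bool]_(d, 2)) (t : 'cV[bool]_d) :
  linear_oracle S oracle -> candidate1 oracle c y -> t \in S ->
  dot (prefix_weight c 2) t <= sco_obj c y.
Proof.
move=> oracleS [s [so clean]] tS.
have [_ /(_ _ so)[_ /(_ _ tS) le_ts]] := oracleS (prefix_weight c 2).
apply: le_trans le_ts _; rewrite dot_col sco_objE; apply: ler_sum => i _.
have := cleaning_prefix_weight clean (leq0n (row_count _ i)).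
have := @cleaning_prefix_weight _ _ _ _ _ 2 i clean.
rewrite row_count2 !mxE; case: (s i ord0) => /= [/(_ isT) h _|_ h].
  by rewrite mulr1.
by rewrite mulr0; apply: le_trans h; have := prefix_weight_ge0 c 0 i; rewrite mxE.
Qed.

(* Both columns of z compete with each oracle answer, so each of the two greedy
   steps covers at least half of the weight still missing. *)
Lemma candidate0_ge (d : nat) (S : {set 'cV[bool]_d})
    (oracle : 'cV[int]_d -> {set 'cV[bool]_d}) (c : 'M[int]_(d, 2))
    (y z : 'M[bool]_(d, 2)) :
  linear_oracle S oracle -> candidate0 oracle c y -> z \in colpow S 2 ->
  3 * (\sum_(i < d | row_count z i == 1%N) prefix_weight c 1 i ord0)
    <= 4 * sco_obj c y.
Proof.
move=> oracleS [_ [[x [xo ->]] clean]]; rewrite inE => /forallP zS.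
pose u i := prefix_weight c 1 i ord0.
have u_ge0 i : 0 <= u i by apply: prefix_weight_ge0.
(* [g1] is the weight covered by the first answer, [g2] the new weight added by the second. *)
pose g1 i := u i * (x i ord0)%:R.
pose g2 i := u i * (~~ x i ord0 && x i ord_max)%:R.
have first_ge j : \sum_i u i * (z i j)%:R <= \sum_i g1 i.
  have [_ /(_ _ (xo ord0))[_ /(_ _ (zS j))]] :=
    oracleS (residual_weight (prefix_weight c 1) x ord0).
  rewrite !dot_col; congr (_ <= _); apply: eq_bigr => i _;
    by rewrite !mxE covered_before0 /g1 /u !mxE.
have second_ge j : \sum_i u i * (~~ x i ord0 && z i j)%:R <= \sum_i g2 i.
  have [_ /(_ _ (xo ord_max))[_ /(_ _ (zS j))]] :=
    oracleS (residual_weight (prefix_weight c 1) x ord_max).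
  rewrite !dot_col; congr (_ <= _); apply: eq_bigr => i _;
    rewrite !mxE covered_before1 /g2 /u !mxE; case: (x i ord0) => //=;
    by rewrite mul0r mulr0.
(* [keep_first] leaves a single one in each covered row, where cleaning earns at least [u i]; other
   rows earn at least 0. *)
have obj_ge : \sum_i g1 i + \sum_i g2 i <= sco_obj c y.
  rewrite sco_objE -big_split; apply: ler_sum => i _ /=.
  have := @cleaning_prefix_weight _ _ _ _ _ 0 i clean (leq0n _).
  have := @cleaning_prefix_weight _ _ _ _ _ 1 i clean.
  have := prefix_weight_ge0 c 0 i.
  rewrite row_count2 [keep_first _ _ _]mxE [keep_first _ _ _]mxE.
  rewrite covered_before0 covered_before1 /g1 /g2 /u.
  by case: (x i ord0); case: (x i ord_max) => //= h0 h1 h2;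
    rewrite ?mulr1 ?mulr0 ?addr0 ?add0r; first [exact: h1 | exact: le_trans h2].
(* A row with a single one in [z] gives [u i] from the columns of [z], and [2 * u i] from [g1] if
   [x] covers it first, from the residual terms otherwise. Summed, the right side is at most four
   times the sum of [g1] and [g2]. *)
have row_le : 3 * (\sum_(i < d | row_count z i == 1%N) u i) <=
    \sum_i (u i * (z i ord0)%:R + u i * (z i ord_max)%:R + (g1 i + g1 i) +
     (u i * (~~ x i ord0 && z i ord0)%:R + u i * (~~ x i ord0 && z i ord_max)%:R) +
     (u i * (~~ x i ord0 && z i ord0)%:R + u i * (~~ x i ord0 && z i ord_max)%:R)).
  rewrite mulr_sumr big_mkcond; apply: ler_sum => i _; rewrite row_count2 /g1.
  have := u_ge0 i.
  by case: (z i ord0); case: (z i ord_max); case: (x i ord0) => /= h; lra.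
rewrite !big_split /= in row_le.
have := first_ge ord0; have := first_ge ord_max.
have := second_ge ord0; have := second_ge ord_max.
rewrite -/u; lra.
Qed.

(** Both columns of [z] are compared with candidate 1 and the two bounds are added, which avoids
    choosing the better column and keeps everything integral. *)
Lemma sco2_output_ge (d : nat) (S : {set 'cV[bool]_d})
    (oracle : 'cV[int]_d -> {set 'cV[bool]_d}) (c : 'M[int]_(d, 2))
    (y z : 'M[bool]_(d, 2)) :
  linear_oracle S oracle -> sco2_output oracle c y -> z \in colpow S 2 ->
  3 * sco_obj c z <= 5 * sco_obj c y.
Proof.
move=> oracleS [y0 [y1 [c0 c1 _ yE]]] zS.
have ge0 := candidate0_ge oracleS c0 zS.
move: (zS); rewrite inE => /forallP zSj.
have := candidate1_ge oracleS c1 (zSj ord0).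
have := candidate1_ge oracleS c1 (zSj ord_max).
rewrite !dot_col => ge1 ge2.
have y_ge0 : sco_obj c y0 <= sco_obj c y by rewrite yE le_max lexx.
have y_ge1 : sco_obj c y1 <= sco_obj c y by rewrite yE le_max lexx orbT.
set a : int := \sum_(i < d | _) _ in ge0.
set b1 : int := \sum_i _ in ge1; set b2 : int := \sum_i _ in ge2.
(* A row with a single one is charged once to [a] and once to the column holding it; a row with two
   ones is charged to both columns. *)
have row_le : 2 * sco_obj c z <= a + b1 + b2.
  rewrite sco_objE mulr_sumr /a /b1 /b2 [X in _ <= X + _ + _]big_mkcond -!big_split; apply: ler_sum => i _ /=.
  rewrite row_count2 ![col _ _ _ _]mxE.
  have := prefix_sum0 c i.
  have := @prefix_weight_ge _ _ c 1 1 i isT.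
  have := @prefix_weight_ge _ _ c 2 2 i isT.
  have := @prefix_weight_homo _ _ c 1 2 i isT.
  have := prefix_weight_ge0 c 1 i.
  case: (z i ord0); case: (z i ord_max) => /=;
    rewrite ?addn0 ?add0n -?[(1 + 1)%N]/2%N;
    move: (prefix_sum c i 0) (prefix_sum c i 1) (prefix_sum c i 2)
          (prefix_weight c 1 i ord0) (prefix_weight c 2 i ord0) => p0 p1 p2 v1 v2;
    clear; lra.
move: (sco_obj c y) (sco_obj c y0) (sco_obj c y1) (sco_obj c z) a b1 b2
  ge0 ge1 ge2 y_ge0 y_ge1 row_le.
(* Tripling [row_le] bounds six times the value of [z] by (4 + 3 + 3) times that of [y]. *)
by clear; move=> *; lra.
Qed.

Theorem theorem5p2 (d : nat) (S : {set 'cV[bool]_d})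
    (oracle : 'cV[int]_d -> {set 'cV[bool]_d}) (c : 'M[int]_(d, 2))
    (indS : independence_system S) (oracleS : linear_oracle S oracle) :
  (exists y : 'M[bool]_(d, 2), sco2_output oracle c y) /\
  (forall y : 'M[bool]_(d, 2), sco2_output oracle c y ->
     y \in colpow S 2 /\
     (3%:R / 5%:R : rat) * (sco_max S c)%:~R <= (sco_obj c y)%:~R).
Proof.
split=> [|y out_y]; first exact: sco2_output_exists oracleS.
split.
  have [y0 [y1 [c0 c1 [->|->] _]]] := out_y.
    exact: candidate0_colpow indS oracleS c0.
  exact: candidate1_colpow indS oracleS c1.
have le35 : 3 * sco_max S c <= 5 * sco_obj c y.
  apply: (big_ind (fun m => 3 * m <= 5 * sco_obj c y)).
  (* The default 0 of the iterated maximum is the value of the zero matrix, so the bound for that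
     matrix covers it. *)
  - have zS : const_mx false \in colpow S 2.
      rewrite inE; apply/forallP => j; case: indS => S0 _.
      by rewrite (_ : col j _ = const_mx false) //; apply/colP => i; rewrite !mxE.
    have := sco2_output_ge oracleS out_y zS.
    rewrite [sco_obj c (const_mx _)]sco_objE big1 // => i _.
    by rewrite row_count2 !mxE prefix_sum0.
  - by move=> m1 m2 le1 le2; rewrite maxEle; case: ifP.
  - by move=> z; apply: sco2_output_ge oracleS out_y.
have : ((3 * sco_max S c)%:~R : rat) <= (5 * sco_obj c y)%:~R by rewrite ler_int.
rewrite !intrM; lra.
Qed.
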